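(* Let $W = W(\Gamma,\mathbf m)$ be a graph product of directly-indecomposable cyclic groups. Then $$\operatorname{Aut}^\ast W = \operatorname{Aut}^0 W \rtimes \operatorname{Aut}^1 W,$$ an internal semidirect product with normal factor $\operatorname{Aut}^0 W$.
   Context: $\Gamma$ is a finite simplicial graph with non-empty vertex set $V=\{v_1,\dots,v_N\}$. An order map is a function $\mathbf m:\{1,\dots,N\}\to\{p^\alpha : p \text{ prime},\ \alpha\ge 1\}\cup\{\infty\}$. The graph product of directly-indecomposable cyclic groups $W=W(\Gamma,\mathbf m)$ is the group with generators $V$ and relations $v_i^{\mathbf m(i)}=1$ (no relation if $\mathbf m(i)=\infty$) and $v_jv_k=v_kv_j$ whenever $v_j,v_k$ are adjacent in $\Gamma$. Vertices are identified with the corresponding generators. For a full subgraph $\Delta$, $W(\Delta)$ is the subgroup of $W$ generated by the vertices of $\Delta$. The maximal complete subgroups of $W$ are the subgroups $W(\Delta)$ with $\Delta$ a maximal complete subgraph (maximal clique) of $\Gamma$. $\operatorname{Aut}^\ast W$ is the subgroup of $\operatorname{Aut} W$ of automorphisms which map each maximal complete subgroup to a conjugate of a maximal complete subgroup. $\operatorname{Aut}^1 W$ is the subgroup of automorphisms which map each maximal complete subgroup to a maximal complete subgroup. $\operatorname{Aut}^0 W$ is the subgroup of automorphisms which map each vertex $v_i$ to a conjugate of itself. *)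

(* Defs.v *)
From HB Require Import structures.
From mathcomp Require Import all_boot.
From mathcomp Require Import boolp classical_sets.

Set Implicit Arguments.
Unset Strict Implicit.
Unset Printing Implicit Defensive.

Local Open Scope classical_set_scope.
Local Open Scope group_scope.
Local Open Scope quotient_scope.

(* The letter [(x, true)] stands for the generator [x], and [(x, false)] for
   its formal inverse. *)
Definition word (X : Type) := seq (X * bool).

Definition word_inv (X : Type) (w : word X) : word X :=
  rev [seq (l.1, ~~ l.2) | l <- w].

(* The congruence on words generated by free cancellation and by the defining
   relations [s = t], for [R s t]. *)
Inductive pres_eq (X : Type) (R : word X -> word X -> Prop) :
    word X -> word X -> Prop :=
| pres_refl s : pres_eq R s s
| pres_sym s t : pres_eq R s t -> pres_eq R t s
| pres_trans s t u : pres_eq R s t -> pres_eq R t u -> pres_eq R s u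
| pres_cat s s' t t' :
    pres_eq R s s' -> pres_eq R t t' -> pres_eq R (s ++ t) (s' ++ t')
| pres_cancel x b : pres_eq R [:: (x, b); (x, ~~ b)] [::]
| pres_rel s t : R s t -> pres_eq R s t.

Section Presented.
Variables (X : choiceType) (R : word X -> word X -> Prop).

Lemma pres_catVw w : pres_eq R (word_inv w ++ w) [::].
Proof.
rewrite /word_inv; elim: w => [|[x b] w IHw] /=; first exact: pres_refl.
rewrite rev_cons cat_rcons.
apply: pres_trans IHw; apply: pres_cat (pres_refl _ _) _.
rewrite -[X in pres_eq _ _ X]cat0s -[[:: _, _ & _]]/([:: _; _] ++ w).
apply: pres_cat (pres_refl _ _).
by have := pres_cancel R x (~~ b); rewrite negbK.
Qed.

Lemma word_invK : involutive (@word_inv X).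
Proof.
move=> w; rewrite /word_inv map_rev revK -map_comp map_id_in // => -[x b] _ /=.
by rewrite negbK.
Qed.

Lemma pres_catwV w : pres_eq R (w ++ word_inv w) [::].
Proof. by have := pres_catVw (word_inv w); rewrite word_invK. Qed.

Lemma pres_inv s t : pres_eq R s t -> pres_eq R (word_inv s) (word_inv t).
Proof.
move=> st; apply: (@pres_trans _ _ _ (word_inv s ++ (t ++ word_inv t))).
  rewrite -[X in pres_eq _ X]cats0; apply: pres_cat (pres_refl _ _) _.
  exact/pres_sym/pres_catwV.
rewrite catA -[X in pres_eq _ _ X]cat0s; apply: pres_cat (pres_refl _ _).
apply: pres_trans (pres_catVw s); apply: pres_cat (pres_refl _ _) _.
exact: pres_sym.
Qed.

Definition pres_eqb (s t : word X) : bool := `[< pres_eq R s t >].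

Lemma pres_eqb_refl : reflexive pres_eqb.
Proof. by move=> s; apply/asboolP/pres_refl. Qed.

Lemma pres_eqb_sym : symmetric pres_eqb.
Proof. by move=> s t; apply/asboolP/asboolP; apply: pres_sym. Qed.

Lemma pres_eqb_trans : transitive pres_eqb.
Proof.
by move=> t s u /asboolP st /asboolP tu; apply/asboolP/(pres_trans st tu).
Qed.

Canonical pres_equiv :=
  EquivRel pres_eqb pres_eqb_refl pres_eqb_sym pres_eqb_trans.

Definition presented := {eq_quot pres_equiv}.

HB.instance Definition _ := Choice.on presented.
HB.instance Definition _ := EqQuotient.on presented.

Definition pres_class (w : word X) : presented := \pi_presented w.

Lemma pres_classP s t : pres_class s = pres_class t <-> pres_eq R s t.
Proof.
split=> [/eqP|st]; first by rewrite /pres_class piE => /asboolP.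
by apply/eqP; rewrite /pres_class piE; apply/asboolP.
Qed.

Definition pres_mul (x y : presented) := pres_class (repr x ++ repr y).
Definition pres_one := pres_class [::].
Definition pres_invg (x : presented) := pres_class (word_inv (repr x)).

Lemma pres_repr_class w : pres_eq R (repr (pres_class w)) w.
Proof. by apply/pres_classP; rewrite {1}/pres_class reprK. Qed.

Lemma pres_class_cat s t :
  pres_mul (pres_class s) (pres_class t) = pres_class (s ++ t).
Proof. by apply/pres_classP/pres_cat; apply: pres_repr_class. Qed.

Lemma pres_class_inv s : pres_invg (pres_class s) = pres_class (word_inv s).
Proof. exact/pres_classP/pres_inv/pres_repr_class. Qed.

Lemma pres_class_repr (x : presented) : pres_class (repr x) = x.
Proof. exact: reprK. Qed.

Lemma pres_mulA : associative pres_mul.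
Proof.
move=> x y z; rewrite -(pres_class_repr x) -(pres_class_repr y).
by rewrite -(pres_class_repr z) !pres_class_cat catA.
Qed.

Lemma pres_mul1 : left_id pres_one pres_mul.
Proof. by move=> x; rewrite -(pres_class_repr x) pres_class_cat. Qed.

Lemma pres_mulr1 : right_id pres_one pres_mul.
Proof. by move=> x; rewrite -(pres_class_repr x) pres_class_cat cats0. Qed.

Lemma pres_mulV : left_inverse pres_one pres_invg pres_mul.
Proof.
move=> x; rewrite -(pres_class_repr x) pres_class_inv pres_class_cat.
exact/pres_classP/pres_catVw.
Qed.

Lemma pres_mulrV : right_inverse pres_one pres_invg pres_mul.
Proof.
move=> x; rewrite -(pres_class_repr x) pres_class_inv pres_class_cat.
exact/pres_classP/pres_catwV.
Qed.

HB.instance Definition _ := isGroup.Build presented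
  pres_mulA pres_mul1 pres_mulr1 pres_mulV pres_mulrV.

End Presented.

Section Automorphisms.
Variable G : groupType.

Record aut := Aut {
  aut_val :> {multiplicative G -> G};
  aut_bij : bijective aut_val
}.

Lemma autP (f g : aut) : f =1 g -> f = g.
Proof.
case: f g => [[f [[fM]]] fb] [[g [[gM]]] gb] /= /funext fg.
case: _ / fg in gM gb *.
by rewrite (Prop_irrelevance fM gM) in fb *; rewrite (Prop_irrelevance fb gb).
Qed.

HB.instance Definition _ := gen_eqMixin aut.
HB.instance Definition _ := gen_choiceMixin aut.

Definition aut_mul (f g : aut) : aut :=
  @Aut (aut_val f \o aut_val g) (bij_comp (aut_bij f) (aut_bij g)).

Definition aut_one : aut := @Aut idfun (Bijective (frefl _) (frefl _)).

Lemma aut_inv_ex (f : aut) : exists g : aut, cancel f g /\ cancel g f.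
Proof.
case: (aut_bij f) => g fK gK.
pose gm := isMultiplicative.Build G G g (can2_gmulfM fK gK).
pose gM : {multiplicative G -> G} := HB.pack g gm.
by exists (@Aut gM (Bijective gK fK)).
Qed.

Definition aut_inv (f : aut) : aut := projT1 (cid (aut_inv_ex f)).

Lemma aut_invK (f : aut) : cancel f (aut_inv f) /\ cancel (aut_inv f) f.
Proof. exact: (projT2 (cid (aut_inv_ex f))). Qed.

Lemma aut_mulA : associative aut_mul.
Proof. by move=> f g h; apply: autP. Qed.

Lemma aut_mul1 : left_id aut_one aut_mul.
Proof. by move=> f; apply: autP. Qed.

Lemma aut_mulr1 : right_id aut_one aut_mul.
Proof. by move=> f; apply: autP. Qed.

Lemma aut_mulV : left_inverse aut_one aut_inv aut_mul.
Proof. by move=> f; apply: autP => x; apply: (aut_invK f).1. Qed.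

Lemma aut_mulrV : right_inverse aut_one aut_inv aut_mul.
Proof. by move=> f; apply: autP => x; apply: (aut_invK f).2. Qed.

HB.instance Definition _ := isGroup.Build aut
  aut_mulA aut_mul1 aut_mulr1 aut_mulV aut_mulrV.

End Automorphisms.

Section Subgroups.
Variable G : groupType.
Implicit Types A H K N : set G.

Definition subgroup H : Prop := group_closed (mem H).

Definition generated A : set G := smallest subgroup A.

Definition conj_set H (g : G) : set G := [set x ^ g | x in H].

(* [A] is the internal semidirect product of its subgroups [N] and [H], with
   normal factor [N]. *)
Definition internal_sdprod N H A : Prop :=
  [/\ [/\ subgroup A, subgroup N & subgroup H],
      N `<=` A /\ H `<=` A,
      forall n a, N n -> A a -> N (n ^ a),
      N `&` H = [set 1] &
      A = [set n * h | n in N & h in H]].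

End Subgroups.

Section GraphProduct.
Variables (V : finType) (E : rel V) (m : V -> option nat).

(* [None] stands for infinite order. *)
Definition order_map : Prop :=
  forall v n, m v = Some n -> exists p a, [/\ prime p, 0 < a & n = (p ^ a)%N].

Inductive gp_rel : word V -> word V -> Prop :=
| gp_order v n : m v = Some n -> gp_rel (nseq n (v, true)) [::]
| gp_comm u v : E u v ->
    gp_rel [:: (u, true); (v, true)] [:: (v, true); (u, true)].

Definition graph_product : groupType := presented gp_rel.

Definition vertex (v : V) : graph_product := pres_class gp_rel [:: (v, true)].

Definition special (D : {set V}) : set graph_product :=
  generated [set vertex v | v in [set` D]].

Definition complete (D : {set V}) : bool :=
  [forall u in D, forall v in D, (u != v) ==> E u v].

Definition max_complete (H : set graph_product) : Prop :=
  exists2 D : {set V}, maxset complete D & H = special D.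

Definition AutStar : set (aut graph_product) :=
  [set f | forall H, max_complete H ->
     exists K g, max_complete K /\ f @` H = conj_set K g].

Definition Aut1 : set (aut graph_product) :=
  [set f | forall H, max_complete H -> max_complete (f @` H)].

Definition Aut0 : set (aut graph_product) :=
  [set f | forall v, exists g, f (vertex v) = vertex v ^ g].

End GraphProduct.

(* Main.v *)
(* An element of a clique subgroup W(D) that is conjugate to an element of a
   clique subgroup is equal to it, as one sees by applying the retractions of W
   onto the two subgroups.  Hence, for f in Aut*, each f(v) is conjugate to a
   unique element h(v) of a clique subgroup, and on every W(D) the map h agrees
   with f up to conjugation.  So h extends to an endomorphism, whose inverse is
   obtained in the same way from f^-1; it lies in Aut^1, and f h^-1 in Aut^0.

   That Aut^0 is contained in Aut* (and normal) requires a simultaneous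
   conjugator on each clique, which is found by retracting onto common stars
   once the centralizer of v is known to be W(star v).  This last fact is
   obtained without normal forms, from a Fox-type derivation of W with
   coefficients modulo the order of v (modulo 2 if it is infinite). *)
From HB Require Import structures.
Require Import Defs.
From mathcomp Require Import all_boot ssralg zmodp.
From mathcomp Require Import boolp classical_sets.

Set Implicit Arguments.
Unset Strict Implicit.
Unset Printing Implicit Defensive.

Local Open Scope classical_set_scope.
Local Open Scope group_scope.

Section Multiplicative.
Variables (G H : groupType) (f : {multiplicative G -> H}).

Lemma multiplicative1 : f 1 = 1.
Proof. by apply: (mulgI (f 1)); rewrite -gmulfM !mulg1. Qed.

(* The library states [gmulfV] and its kin for unital morphisms only, although
   between groups unitality is automatic. *)
Let unital : UMagmaMorphism.type G H :=
  HB.pack (f : G -> H) (isMultiplicative.Build G H f (@gmulfM G H f))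
    (Multiplicative_isUMagmaMorphism.Build G H f multiplicative1).

Lemma multiplicativeV : {morph f : x / x^-1}.
Proof. exact: (gmulfV unital). Qed.

Lemma multiplicativeX n : {morph f : x / x ^+ n}.
Proof. exact: (gmulfXn unital). Qed.

Lemma multiplicativeJ : {morph f : x y / x ^ y}.
Proof. exact: (gmulfJ unital). Qed.

End Multiplicative.

(** * Subgroups, conjugates and images under automorphisms *)

Section Groups.
Variable G : groupType.
Implicit Types (x y z g : G) (H A : set G).

Lemma subgroup_intro H :
  H 1 -> (forall x, H x -> H x^-1) -> (forall x y, H x -> H y -> H (x * y)) ->
  subgroup H.
Proof.
move=> H1 HV HM; split=> [|x y]; rewrite !inE // => Hx Hy.
exact/HM/HV.
Qed.

Lemma subgroup1 H : subgroup H -> H 1.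
Proof. by case; rewrite inE. Qed.

Lemma subgroupV H x : subgroup H -> H x -> H x^-1.
Proof. by move=> [H1 HD] Hx; have:= HD 1 x H1; rewrite !inE div1g; apply. Qed.

Lemma subgroupM H x y : subgroup H -> H x -> H y -> H (x * y).
Proof.
move=> sH Hx Hy; have:= sH.2 x y^-1; rewrite !inE invgK; apply=> //.
exact: subgroupV.
Qed.

Lemma subgroup_generated A : subgroup (generated A).
Proof.
apply: subgroup_intro => [M [sM _]|x Hx M [sM AM]|x y Hx Hy M [sM AM]].
- exact: subgroup1.
- by apply: subgroupV => //; apply: Hx.
- by apply: subgroupM => //; [apply: Hx|apply: Hy].
Qed.

Lemma conj_set1 H : conj_set H 1 = H.
Proof.
apply/seteqP; split=> [_ [x Hx <-]|x Hx]; first by rewrite conjg1.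
by exists x => //; rewrite conjg1.
Qed.

Lemma conj_setM H g k : conj_set H (g * k) = conj_set (conj_set H g) k.
Proof.
apply/seteqP; split=> [_ [x Hx <-]|_ [_ [x Hx <-] <-]].
  by exists (x ^ g); [exists x|rewrite conjgM].
by exists x => //; rewrite conjgM.
Qed.

Lemma autK (f : aut G) : cancel f (f^-1 : aut G).
Proof. exact: (aut_invK f).1. Qed.

Lemma aut_image_conj (f : aut G) H g :
  f @` conj_set H g = conj_set (f @` H) (f g).
Proof.
apply/seteqP; split=> [_ [_ [x Hx <-] <-]|_ [_ [x Hx <-] <-]].
  by exists (f x); [exists x|rewrite multiplicativeJ].
by exists (x ^ g); [exists x|rewrite multiplicativeJ].
Qed.

Lemma aut_image_inv (f : aut G) H : (f^-1 : aut G) @` (f @` H) = H.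
Proof.
apply/seteqP; split=> [_ [_ [x Hx <-] <-]|x Hx]; first by rewrite autK.
by exists (f x); [exists x|rewrite autK].
Qed.

End Groups.

(** * Actions of, and morphisms from, a presented group *)

Section Presented.
Variables (X : choiceType) (R : word X -> word X -> Prop).

Section Action.
Variables (T : Type) (act actV : X -> T -> T).

Definition letter_act (l : X * bool) : T -> T :=
  if l.2 then act l.1 else actV l.1.

Definition word_act (s : word X) (t : T) : T := foldr letter_act t s.

Lemma word_act_nseq n x t : word_act (nseq n (x, true)) t = iter n (act x) t.
Proof. by elim: n => //= n ->. Qed.

Hypotheses (actK : forall x, cancel (act x) (actV x))
  (actVK : forall x, cancel (actV x) (act x))
  (actR : forall s t, R s t -> word_act s =1 word_act t).

(** An action that respects the relations descends to the presented group; it serves both to map out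
    of the group and to tell its elements apart. *)
Lemma word_act_pres s t : pres_eq R s t -> word_act s =1 word_act t.
Proof.
elim=> // [{}s {}t _ IH y|{}s t1 u _ IH1 _ IH2 y
         |s1 s2 t1 t2 _ IH1 _ IH2 y|x b y].
- by rewrite IH.
- by rewrite IH1 IH2.
- by rewrite /word_act !foldr_cat -!/(word_act _ _) IH2 IH1.
- by case: b => /=; [exact: actVK|exact: actK].
Qed.

End Action.

Lemma pres_class_ind (P : presented R -> Prop) :
  P 1 -> (forall x y, P y -> P (pres_class R [:: (x, true)] * y)) ->
  (forall x y, P y -> P ((pres_class R [:: (x, true)])^-1 * y)) ->
  forall y, P y.
Proof.
move=> P1 PM PV y; rewrite -(pres_class_repr y).
elim: (repr y) => [|[x b] s IHs]; first exact: P1.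
rewrite -cat1s -pres_class_cat.
case: b; first exact: PM.
have -> : pres_class R [:: (x, false)] = (pres_class R [:: (x, true)])^-1.
  by symmetry; apply: pres_class_inv.
exact: PV.
Qed.

Variable H : groupType.

Lemma presented_hom_ext (h k : {multiplicative presented R -> H}) :
  (forall x : X, let c := pres_class R [:: (x, true)] in h c = k c) ->
  h =1 k.
Proof.
move=> hk; apply: pres_class_ind => [|x y IH|x y IH].
- by rewrite !multiplicative1.
- by rewrite !gmulfM IH hk.
- by rewrite !gmulfM !multiplicativeV IH hk.
Qed.

Variable a : X -> H.

Let prod_act := word_act (fun x y => a x * y) (fun x y => (a x)^-1 * y).

(** Universal property: letters act on [H] by left translation, and a word is sent to the point to
    which it moves 1. *)
Lemma presented_hom :
  (forall s t, R s t -> prod_act s =1 prod_act t) ->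
  exists h : {multiplicative presented R -> H},
    forall x, h (pres_class R [:: (x, true)]) = a x.
Proof.
move=> actR.
have hP s t : pres_eq R s t -> prod_act s 1 = prod_act t 1.
  by move=> st; apply: (word_act_pres _ _ actR st) => x y;
    rewrite ?mulKg ?mulVKg.
(* The action commutes with right translations, which makes [h0] multiplicative. *)
have actM s y : prod_act s y = prod_act s 1 * y.
  elim: s => [|[x b] s IHs] /=; first by rewrite mul1g.
  by rewrite /letter_act /=; case: b; rewrite -/(prod_act _ _) IHs -mulgA.
pose h0 (y : presented R) := prod_act (repr y) 1.
have hM : {morph h0 : y z / y * z}.
  move=> y z; rewrite /h0 -actM (hP _ _ (pres_repr_class R (repr y ++ repr z))).
  by rewrite /prod_act /word_act foldr_cat.
pose h : {multiplicative presented R -> H} :=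
  HB.pack h0 (isMultiplicative.Build _ _ h0 hM).
exists h => x; rewrite /= /h0 (hP _ _ (pres_repr_class R [:: (x, true)])).
exact: mulg1.
Qed.

End Presented.

(** * Special subgroups of a graph product and their retractions *)

Section GraphProduct.
Variables (V : finType) (E : rel V) (m : V -> option nat).
Local Notation W := (graph_product E m).
Local Notation vert := (vertex E m).
Local Notation sp := (@special V E m).
Implicit Types (D : {set V}) (x y g : W).

Lemma vertex_order v n : m v = Some n -> vert v ^+ n = 1.
Proof.
move=> mv; rewrite -iter_mulg_1.
rewrite (_ : iter n _ _ = pres_class (gp_rel E m) (nseq n (v, true))).
  exact/pres_classP/pres_rel/gp_order.
elim: n {mv} => //= n ->; exact: pres_class_cat.
Qed.

Lemma vertex_comm u v : E u v -> commute (vert u) (vert v).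
Proof.
move=> uv; rewrite /commute.
transitivity (pres_class (gp_rel E m) [:: (u, true); (v, true)]).
  exact: pres_class_cat.
transitivity (pres_class (gp_rel E m) [:: (v, true); (u, true)]).
  exact/pres_classP/pres_rel/gp_comm.
symmetry; exact: pres_class_cat.
Qed.

Lemma graph_product_hom_ext (H : groupType) (h k : {multiplicative W -> H}) :
  (forall v, h (vert v) = k (vert v)) -> h =1 k.
Proof. exact: presented_hom_ext. Qed.

Lemma graph_product_hom (H : groupType) (a : V -> H) :
  (forall v n, m v = Some n -> a v ^+ n = 1) ->
  (forall u v, E u v -> commute (a u) (a v)) ->
  exists h : {multiplicative W -> H}, forall v, h (vert v) = a v.
Proof.
move=> aX aC; apply: presented_hom => s t [v n /aX av1|u v /aC uv] y /=.
  by rewrite word_act_nseq iter_mulg av1 mul1g.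
by rewrite /letter_act /= !mulgA uv.
Qed.

Lemma special_subgroup D : subgroup (sp D).
Proof. exact: subgroup_generated. Qed.

Lemma vertex_special (D : {set V}) v : v \in D -> sp D (vert v).
Proof. by move=> vD; apply: sub_gen_smallest; exists v. Qed.

Lemma special_sub D (H : set W) :
  subgroup H -> (forall v, v \in D -> H (vert v)) -> sp D `<=` H.
Proof. by move=> sH DH; apply: smallest_sub => // _ [v vD <-]; apply: DH. Qed.

Lemma special_hom_ext D (H : groupType) (h k : {multiplicative W -> H}) :
  (forall v, v \in D -> h (vert v) = k (vert v)) ->
  forall x, sp D x -> h x = k x.
Proof.
move=> hk; apply: special_sub hk.
apply: subgroup_intro => [|x hkx|x y hkx hky] /=.
- by rewrite !multiplicative1.
- by rewrite !multiplicativeV hkx.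
- by rewrite !gmulfM hkx hky.
Qed.

Lemma special_commute D (y : W) :
  (forall v, v \in D -> commute y (vert v)) -> forall x, sp D x -> commute y x.
Proof.
move=> yD; apply: special_sub yD; apply: subgroup_intro => [|x|x z] /=.
- exact: commute1.
- exact: commuteV.
- exact: commuteM.
Qed.

Lemma retraction_ex (D : {set V}) :
  exists r : {multiplicative W -> W},
    forall v, r (vert v) = if v \in D then vert v else 1.
Proof.
apply: graph_product_hom => [v n mv|u v uv].
  by case: ifP => _; [exact: vertex_order|exact: expg1n].
case: ifP => _; last exact/commute_sym/commute1.
by case: ifP => _; [exact: vertex_comm|exact: commute1].
Qed.

Definition retraction D : {multiplicative W -> W} :=
  projT1 (cid (retraction_ex D)).
Local Notation ret := retraction.

Lemma retraction_vertex D v : ret D (vert v) = if v \in D then vert v else 1.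
Proof. exact: (projT2 (cid (retraction_ex D))). Qed.

Lemma retraction_id D x : sp D x -> ret D x = x.
Proof.
apply: (@special_hom_ext _ _ (ret D) idfun) => v vD.
by rewrite retraction_vertex vD.
Qed.

Lemma retraction_in D x : sp D (ret D x).
Proof.
have sD := special_subgroup D.
have rv v : sp D (ret D (vert v)).
  rewrite retraction_vertex; case: ifP => [|_]; [exact: vertex_special|].
  exact: subgroup1.
move: x; apply: pres_class_ind => [|v x Dx|v x Dx].
- by rewrite multiplicative1; apply: subgroup1.
- by rewrite gmulfM; apply: subgroupM (rv v) Dx.
- rewrite gmulfM multiplicativeV; apply: subgroupM Dx => //.
  by apply: subgroupV (rv v).
Qed.

Lemma retraction_special D D' x : sp D x -> sp (D :&: D')%SET (ret D' x).
Proof.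
have sI := special_subgroup (D :&: D')%SET.
move: x; apply: special_sub => [|v vD] /=.
  apply: subgroup_intro => [|x|x y] /=.
  - by rewrite multiplicative1; apply: subgroup1.
  - by rewrite multiplicativeV; apply: subgroupV.
  - by rewrite gmulfM; apply: subgroupM.
rewrite retraction_vertex; case: ifP => vD'; last exact: subgroup1.
by apply: vertex_special; rewrite inE vD.
Qed.

(** [x] is fixed by the retraction onto [D'], which maps [sp D] into [sp (D :&: D')]. *)
Lemma special_setI D D' : sp D `&` sp D' `<=` sp (D :&: D')%SET.
Proof.
by move=> x [Dx D'x]; rewrite -(retraction_id D'x); apply: retraction_special.
Qed.

Lemma special_subset (D D' : {set V}) : D \subset D' -> sp D `<=` sp D'.
Proof.
move=> /fintype.subsetP DD'; apply: special_sub => [|v /DD'].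
  exact: special_subgroup.
exact: vertex_special.
Qed.

(** * Nontriviality and centralizers of vertices *)

Hypothesis m_order : order_map m.

(** Counting [v] modulo [n] respects its order relation, and [1 < n] keeps 0 and 1 distinct in
    ['Z_n]; 2 is an arbitrary choice for infinite order. *)
Let vertex_modulus v : exists n, 1 < n /\
  forall k, m v = Some k -> k = n.
Proof.
case mv: (m v) => [n|]; last by exists 2.
exists n; split=> [|k [<-]//].
have [p [a [p_pr a_gt0 ->]]] := m_order mv.
by rewrite -(exp1n a) ltn_exp2r // prime_gt1.
Qed.

(** The exponent sum of [v] modulo [n], realised as an action on ['Z_n] by translations, takes the
    value 1 on [v]. *)
Lemma vertex_neq1 v : vert v != 1.
Proof.
have [n [n_gt1 mvn]] := vertex_modulus v.
apply/eqP => v1.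
pose act (u : V) (t : 'Z_n) : 'Z_n := (t + (u == v)%:R)%R.
pose actV (u : V) (t : 'Z_n) : 'Z_n := (t - (u == v)%:R)%R.
have iter_act k u t : iter k (act u) t = (t + (u == v)%:R *+ k)%R.
  elim: k => [|k IHk]; first by rewrite GRing.addr0.
  by rewrite iterS IHk /act GRing.mulrSr GRing.addrA.
have actR s t : gp_rel E m s t -> word_act act actV s =1 word_act act actV t.
  move=> [u k mu|u w _] z /=.
    rewrite word_act_nseq iter_act; case: eqP mu => [-> /mvn->|_ _].
      by rewrite pchar_Zp // GRing.addr0.
    by rewrite GRing.mul0rn GRing.addr0.
  by rewrite /letter_act /act /= -!GRing.addrA [(_%:R + _)%R]GRing.addrC.
have actK u : cancel (act u) (actV u) by move=> t; apply: GRing.addrK.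
have actVK u : cancel (actV u) (act u) by move=> t; apply: GRing.subrK.
have /pres_classP/(word_act_pres actK actVK actR)/(_ 0%R) : vert v = 1 by [].
rewrite /= /letter_act /act /= eqxx GRing.add0r => /eqP.
by rewrite GRing.oner_eq0.
Qed.

Definition star (v : V) : {set V} := [set u | (u == v) || E u v]%SET.

Hypothesis E_sym : symmetric E.

(* [W] acts on pairs of functions [(q, f)]: along the orbit of [b], formed by
   the indicator function of [W(star v)] and 0, the component [q] is the
   indicator function of the coset [x W(star v)], and [f] is the first-order
   part of a Fox derivative of [x] over the dual numbers.  As [v] fixes [b], the
   elements [x] and [x v = v x] move [b] to the same pair; evaluating at [v]
   gives [q 1 = 1], that is, [x] lies in [W(star v)]. *)
Lemma vertex_centralizer v x : commute x (vert v) -> sp (star v) x.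
Proof.
move=> xv.
have [n [n_gt1 mvn]] := vertex_modulus v.
have sK := special_subgroup (star v).
pose K (w : W) : 'Z_n := (`[< sp (star v) w >] : nat)%:R%R.
have KM u w : u \in star v -> K ((vert u)^-1 * w) = K w.
  move=> /vertex_special Ku; rewrite /K.
  congr (nat_of_bool _)%:R%R; apply: asbool_equiv_eq.
  split=> [Kuw|]; last exact: (subgroupM sK (subgroupV sK Ku)).
  by rewrite -(mulVKg (vert u) w); apply: (subgroupM sK).
have vs : v \in star v by rewrite inE eqxx.
pose e (u : V) : 'Z_n := (u == v)%:R%R.
pose T := ((W -> 'Z_n) * (W -> 'Z_n))%type.
pose act (u : V) (t : T) : T :=
  (fun w => t.1 ((vert u)^-1 * w)%g, fun w =>
   t.2 ((vert u)^-1 * w)%g + e u * (K w - t.1 ((vert u)^-1 * w)%g))%R.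
pose actV (u : V) (t : T) : T :=
  (fun w => t.1 (vert u * w)%g, fun w =>
   t.2 (vert u * w)%g - e u * (K (vert u * w)%g - t.1 (vert u * w)%g))%R.
have actK u : cancel (act u) (actV u).
  move=> [q f]; rewrite /act /actV /=; congr pair; apply/funext => w /=.
    by rewrite mulKg.
  by rewrite mulKg GRing.addrK.
have actVK u : cancel (actV u) (act u).
  move=> [q f]; rewrite /act /actV /=; congr pair; apply/funext => w /=.
    by rewrite mulVKg.
  by rewrite mulVKg GRing.subrK.
(* All [k] increments agree: [e u] vanishes unless [u = v], and [K] is invariant under left
   multiplication by [v]. For [u = v] and [k = n] they sum to 0. *)
have iter_act k u t : iter k (act u) t =
    (fun w => t.1 ((vert u) ^- k * w)%g, fun w =>
      t.2 ((vert u) ^- k * w)%g +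
      e u * (K w - t.1 ((vert u) ^- k * w)%g) *+ k)%R.
  case: t => q f; elim: k => [|k IHk] /=.
    congr pair; apply/funext => w; rewrite expg0 invg1 mul1g //.
    by rewrite GRing.addr0.
  rewrite IHk /act /=; congr pair; apply/funext => w.
    by rewrite mulgA -invgM -expgS.
  rewrite mulgA -invgM -expgS GRing.mulrSr GRing.addrA.
  congr (_ + _ *+ _ + _)%R.
  by rewrite /e; case: eqP => [->|_]; [rewrite KM|rewrite !GRing.mul0r].
(* Only [u = v] matters, and then [u'] is adjacent to [v], so [K] ignores it. *)
have comm_e u u' w : E u u' -> (e u * K ((vert u')^-1 * w)%g = e u * K w)%R.
  move=> uv; rewrite /e; case: eqP uv => [->|_ _]; last by rewrite !GRing.mul0r.
  by move=> vu; rewrite KM // inE E_sym vu orbT.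
have actR s t : gp_rel E m s t -> word_act act actV s =1 word_act act actV t.
  move=> [u k mu|u u' uu'] [q f].
    rewrite word_act_nseq iter_act /= (vertex_order mu).
    congr pair; apply/funext => w; rewrite invg1 mul1g //.
    rewrite /e; case: eqP mu => [-> /mvn->|_ _]; last first.
      by rewrite GRing.mul0r GRing.mul0rn GRing.addr0.
    by rewrite -GRing.mulr_natr pchar_Zp // GRing.mulr0 GRing.addr0.
  have u'u : E u' u by rewrite E_sym.
  rewrite /= /letter_act /act /=; congr pair; apply/funext => w.
    by rewrite !mulgA -!invgM vertex_comm.
  rewrite !mulgA -!invgM (vertex_comm uu') !GRing.mulrBr !comm_e //.
  exact: GRing.addrAC.
pose b : T := (K, fun=> 0%R).
have bv : act v b = b.
  rewrite /act /b /=; congr pair; apply/funext => w; rewrite KM //.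
  by rewrite GRing.subrr GRing.mulr0 GRing.addr0.
have xK : pres_class (gp_rel E m) (repr x) = x by apply: pres_class_repr.
set s := repr x in xK.
have sv : pres_eq (gp_rel E m) (s ++ [:: (v, true)]) ((v, true) :: s).
  by apply/pres_classP; rewrite -[_ :: s]cat1s -!pres_class_cat xK; apply: xv.
have {sv} := word_act_pres actK actVK actR sv b.
rewrite {1}/word_act foldr_cat /= /letter_act /= bv -/(word_act _ _ _ _).
have KMr w : K (w * vert v) = K w.
  have Kv := vertex_special vs; rewrite /K.
  congr (nat_of_bool _)%:R%R; apply: asbool_equiv_eq.
  split=> Kw; last exact: (subgroupM sK).
  by rewrite -(mulgK (vert v) w); apply: (subgroupM sK Kw (subgroupV sK Kv)).
(* By induction on the word, [t.1] is a translate of [K], and [t.2] inherits from [K] the invariance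
   under right multiplication by [v]. *)
have [t1 t2] : let t := word_act act actV s b in
    (forall w, t.1 w = K (x^-1 * w)) /\
    (forall w, t.2 (w * vert v) = t.2 w).
  rewrite -xK; elim: (s) => [|[u c] s' [IH1 IH2]] /=.
    by split=> // w; rewrite (_ : pres_class _ _ = 1) // invg1 mul1g.
  have -> : pres_class (gp_rel E m) ((u, c) :: s') =
      (if c then vert u else (vert u)^-1) * pres_class (gp_rel E m) s'.
    rewrite -cat1s -pres_class_cat; congr (_ * _); case: c => //.
    by symmetry; apply: pres_class_inv.
  case: c; rewrite /letter_act /act /actV /=; split=> w.
  - by rewrite IH1 invgM mulgA.
  - by rewrite !IH1 !mulgA KMr IH2 KMr.
  - by rewrite IH1 invgM invgK mulgA.
  - by rewrite !IH1 !mulgA !KMr IH2.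
(* At [v] the terms [f v] and [f 1] cancel, leaving [K v = q 1 = K x^-1], where [K v] is 1. *)
case: (word_act _ _ _ _) t1 t2 => q f /= t1 t2 [_ /(congr1 (@^~ (vert v)))].
rewrite mulVg /e eqxx t1 mulg1 -[X in f X]mul1g t2 -{1}[f 1]GRing.addr0.
move=> /GRing.addrI /esym/eqP; rewrite GRing.mul1r GRing.subr_eq0.
rewrite -[vert v]mul1g KMr /K (asboolT (subgroup1 sK)).
case: asboolP => [|_]; last by rewrite GRing.oner_eq0.
by move/(subgroupV sK); rewrite invgK.
Qed.

(** * Conjugacy between clique subgroups *)

Lemma complete_commute D x y : complete E D -> sp D x -> sp D y -> commute x y.
Proof.
move=> cD Dx; apply: special_commute => v vD; apply/commute_sym.
move: x Dx; apply: special_commute => u uD.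
have [->|vu] := eqVneq v u; first exact: commute_refl.
apply: vertex_comm; move/forall_inP: cD => /(_ v vD)/forall_inP/(_ u uD).
by rewrite vu.
Qed.

Lemma conj_commute x g : commute x g -> x ^ g = x.
Proof. by move=> xg; rewrite conjgE xg mulKg. Qed.

(** Clique subgroups are abelian, so retracting [x ^ g] onto [sp D] removes [g] and returns [x].
    This puts [x] in [sp D'], and retracting onto [sp D'] then gives [x ^ g = x]. *)
Lemma special_conj_eq D D' x g :
  complete E D -> complete E D' -> sp D x -> sp D' (x ^ g) -> x ^ g = x.
Proof.
move=> cD cD' Dx D'xg.
have xE : ret D (x ^ g) = x.
  rewrite multiplicativeJ (retraction_id Dx) conj_commute //.
  by apply: complete_commute Dx _ => //; apply: retraction_in.
have D'x : sp D' x.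
  rewrite -xE; apply: (special_subset (finset.subsetIl D' D)).
  exact: retraction_special.
rewrite -(retraction_id D'xg) multiplicativeJ (retraction_id D'x).
rewrite conj_commute //.
by apply: complete_commute D'x _ => //; apply: retraction_in.
Qed.

Lemma special_vertex D v : sp D (vert v) -> v \in D.
Proof.
move/retraction_id; rewrite retraction_vertex; case: ifP => // _ /esym/eqP.
by rewrite (negPf (vertex_neq1 v)).
Qed.

Lemma special_conj_sub D D' g :
  complete E D -> complete E D' -> conj_set (sp D) g `<=` sp D' -> D \subset D'.
Proof.
move=> cD cD' DD'; apply/fintype.subsetP => v vD.
have D'v : sp D' (vert v ^ g).
  by apply: DD'; exists (vert v) => //; apply: vertex_special.
apply: special_vertex.
by rewrite -(special_conj_eq cD cD' (vertex_special vD) D'v).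
Qed.

Lemma special_setT x : sp [set: V]%SET x.
Proof.
have <- : ret [set: V]%SET x = x.
  apply: (@graph_product_hom_ext _ (ret [set: V]%SET) idfun) => v.
  by rewrite retraction_vertex inE.
exact: retraction_in.
Qed.

(** * Simultaneous conjugators on a clique *)

Definition common_star (s : seq V) : {set V} :=
  [set w | all (fun u => w \in star u) s]%SET.

Lemma vertices_centralizer (s : seq V) x :
  (forall u, u \in s -> commute x (vert u)) -> sp (common_star s) x.
Proof.
elim: s => [_|u s IHs xs].
  rewrite (_ : common_star _ = [set: V]%SET); first exact: special_setT.
  by apply/setP => w; rewrite !inE.
have -> : common_star (u :: s) = (star u :&: common_star s)%SET.
  by apply/setP => w; rewrite inE [RHS]inE [X in _ && X]inE.
apply: special_setI; split.
  by apply: vertex_centralizer; apply: xs; rewrite inE eqxx.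
by apply: IHs => w ws; apply: xs; rewrite inE ws orbT.
Qed.

Lemma common_star_commute (s : seq V) x u :
  u \in s -> sp (common_star s) x -> commute x (vert u).
Proof.
move=> us Sx; apply/commute_sym; move: x Sx; apply: special_commute => w.
rewrite inE => /allP/(_ u us); rewrite inE => /predU1P[->|].
  exact: commute_refl.
by move/vertex_comm/commute_sym.
Qed.

(* If [f u = u ^ g] for the earlier vertices [u] and [f v = v ^ h], then
   [v ^ (h g^-1)] centralizes these [u]; so [h g^-1] may be replaced by its
   retraction to the common star, which commutes with them. *)
Lemma Aut0_conj (f : aut W) D :
  @Aut0 V E m f -> complete E D ->
  exists g, forall x, sp D x -> f x = x ^ g.
Proof.
move=> f0 cD.
suff [g fg] : exists g, forall v, v \in enum D -> f (vert v) = vert v ^ g.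
  pose cg y := y ^ g.
  have cgM : {morph cg : y z / y * z} by move=> y z; apply: conjMg.
  pose c : {multiplicative W -> W} :=
    HB.pack cg (isMultiplicative.Build _ _ cg cgM).
  exists g; apply: (@special_hom_ext _ _ f c) => v vD /=.
  by rewrite fg // mem_enum.
have : {subset enum D <= D} by move=> v; rewrite mem_enum.
elim: (enum D) => [_|v s IHs sD]; first by exists 1.
have [u us|g fg] := IHs; first by apply: sD; rewrite inE us orbT.
have [h fh] := f0 v.
have vD : v \in D by apply: sD; rewrite inE eqxx.
have vs : v \in common_star s.
  rewrite inE; apply/allP => u us; rewrite inE; have [//|vu /=] := eqVneq v u.
  have uD : u \in D by apply: sD; rewrite inE us orbT.
  by move/forall_inP: cD => /(_ v vD)/forall_inP/(_ u uD); rewrite vu.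
pose r := ret (common_star s) (h * g^-1).
(* [v] and [v ^ (h * g^-1)] both lie in [sp (common_star s)], so the retraction fixes them and
   changes only the conjugator. *)
have vr : vert v ^ r = vert v ^ (h * g^-1).
  rewrite -[in LHS](retraction_id (vertex_special vs)) -multiplicativeJ.
  apply: retraction_id; apply: vertices_centralizer => u us.
  have uD : u \in D by apply: sD; rewrite inE us orbT.
  rewrite conjgM -fh -[vert u](conjgK g) -fg //.
  have := complete_commute cD (vertex_special vD) (vertex_special uD).
  move/(gmulf_commute f) => fvu; rewrite /commute -!conjMg.
  by congr (_ ^ _); apply: fvu.
exists (r * g) => u; rewrite inE => /predU1P[->|us].
  by rewrite fh conjgM vr -conjgM mulgVK.
rewrite fg // conjgM [_ ^ r]conj_commute //; apply/commute_sym.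
by apply: common_star_commute us _; apply: retraction_in.
Qed.

(** * Maximal complete subgroups and the three groups of automorphisms *)

Local Notation maxc := (maxset (complete E)).
Local Notation Aut0 := (@Aut0 V E m).
Local Notation Aut1 := (@Aut1 V E m).
Local Notation AutStar := (@AutStar V E m).
Implicit Types f n a : aut W.

Lemma max_clique_ex D : complete E D -> exists2 D', maxc D' & D \subset D'.
Proof. by case/maxset_exists => D' ? ?; exists D'. Qed.

Lemma vertex_max_clique v : exists2 D, maxc D & v \in D.
Proof.
have [|D mD sD] := @max_clique_ex [set v]%SET.
  apply/forall_inP => u /set1P->; apply/forall_inP => w /set1P->.
  by rewrite eqxx.
by exists D => //; rewrite -finset.sub1set.
Qed.

Lemma edge_max_clique u v : E u v -> exists D, [/\ maxc D, u \in D & v \in D].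
Proof.
move=> uv; have [|D mD] := @max_clique_ex [set u; v]%SET.
  apply/forall_inP => a /set2P abE; apply/forall_inP => b /set2P bE.
  by case: abE bE => -> [] ->; rewrite ?eqxx // ?(E_sym v) uv implybT.
by rewrite finset.subUset !finset.sub1set => /andP[uD vD]; exists D.
Qed.

Lemma maxc_complete D : maxc D -> complete E D.
Proof. exact: maxsetp. Qed.

(** Conjugation gives an inclusion of cliques, which the maximality of [D] makes an equality. *)
Lemma max_conj_eq D D' g :
  maxc D -> maxc D' -> conj_set (sp D) g = sp D' -> D = D'.
Proof.
move=> mD mD' DD'; apply/esym/(maxsetsup mD); first exact: maxc_complete.
by apply: (@special_conj_sub _ _ g); rewrite ?DD' //; apply: maxc_complete.
Qed.

Lemma AutStar_clique f D : AutStar f -> maxc D ->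
  exists D' g, maxc D' /\ f @` sp D = conj_set (sp D') g.
Proof.
move=> fS mD; have [|K [g [[D' mD' ->] fD]]] := fS (sp D); first by exists D.
by exists D', g.
Qed.

Lemma AutStar_intro f :
  (forall D, maxc D ->
    exists D' g, maxc D' /\ f @` sp D = conj_set (sp D') g) ->
  AutStar f.
Proof.
move=> fP _ [D mD ->]; have [D' [g [mD' fD]]] := fP D mD.
by exists (sp D'), g; split=> //; exists D'.
Qed.

(* [f] acts injectively, hence surjectively, on the finite set of conjugacy
   classes of maximal complete subgroups. *)
Lemma AutStar_surj f D' : AutStar f -> maxc D' ->
  exists D g, maxc D /\ f @` sp D = conj_set (sp D') g.
Proof.
move=> fS mD'.
have /choice[t tP] : forall D, exists D', maxc D ->
    maxc D' /\ exists g, f @` sp D = conj_set (sp D') g.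
  move=> D; case mD: (maxc D); last by exists D.
  have [D1 [g [mD1 fD]]] := AutStar_clique fS mD.
  by exists D1 => _; split=> //; exists g.
pose M := [set D | maxc D]%SET.
have t_inj : {in M &, injective t}.
  move=> D1 D2; rewrite !inE => mD1 mD2 t12.
  have [_ [g1 f1]] := tP _ mD1; have [_ [g2 f2]] := tP _ mD2.
  (* [g1^-1 * g2] conjugates the image of [sp D1] onto that of [sp D2]; [f^-1] pulls this back. *)
  apply: (@max_conj_eq _ _ ((f^-1 : aut W) (g1^-1 * g2))) => //.
  rewrite -[sp D2](aut_image_inv f) -[sp D1](aut_image_inv f) -aut_image_conj.
  by rewrite f1 f2 -conj_setM mulVKg t12.
have tM : t @: M = M.
  apply/eqP; rewrite eqEcard card_in_imset // leqnn andbT.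
  by apply/fintype.subsetP => _ /imsetP[D DM ->]; move: DM;
     rewrite !inE => /tP[].
have : D' \in t @: M by rewrite tM inE.
case/imsetP => D; rewrite inE => mD D'E; have [_ [g fD]] := tP D mD.
by exists D, g; rewrite D'E.
Qed.

Lemma aut_image_mul (f g : aut W) (H : set W) : (f * g) @` H = f @` (g @` H).
Proof. by rewrite -image_comp. Qed.

Lemma aut_image1 (H : set W) : (1 : aut W) @` H = H.
Proof. exact: image_id. Qed.

(** Inverses are the delicate point: by [AutStar_surj] every [sp D] is, up to conjugation, the image
    of some [sp D']. *)
Lemma subgroup_AutStar : subgroup AutStar.
Proof.
apply: subgroup_intro => [|f fS|f g fS gS]; apply: AutStar_intro => D mD.
- by exists D, 1; rewrite conj_set1 aut_image1.
- have [D' [g [mD' fD']]] := AutStar_surj fS mD.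
  exists D', ((f^-1 : aut W) g^-1); split=> //.
  rewrite -[sp D'](aut_image_inv f) -aut_image_conj fD'.
  by rewrite -conj_setM mulgV conj_set1.
- have [D1 [x [mD1 gD]]] := AutStar_clique gS mD.
  have [D2 [y [mD2 fD1]]] := AutStar_clique fS mD1.
  exists D2, (y * f x); split=> //.
  by rewrite aut_image_mul gD aut_image_conj fD1 conj_setM.
Qed.

Lemma Aut1_sub_AutStar : Aut1 `<=` AutStar.
Proof.
move=> f f1 H mH; exists (f @` H), 1; rewrite conj_set1; split=> //; exact: f1.
Qed.

Lemma subgroup_Aut1 : subgroup Aut1.
Proof.
apply: subgroup_intro => [H|f f1 _ [D mD ->]|f g f1 g1 H mH].
- by rewrite aut_image1.
- have [D' [g [mD' fD']]] := AutStar_surj (Aut1_sub_AutStar f1) mD.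
  (* The image [sp D2] of [sp D'] is conjugate to [sp D], hence [D2 = D]. *)
  have [|D2 mD2 fD2] := f1 (sp D'); first by exists D'.
  exists D' => //; rewrite -[sp D'](aut_image_inv f) fD2; congr (_ @` sp _).
  apply: (@max_conj_eq _ _ g) => //; by rewrite -fD' fD2.
- by rewrite aut_image_mul; apply/f1/g1.
Qed.

Lemma subgroup_Aut0 : subgroup Aut0.
Proof.
apply: subgroup_intro => [v|f f0 v|f g f0 g0 v].
- by exists 1; rewrite conjg1.
- have [g fg] := f0 v; exists ((f^-1 : aut W) g)^-1.
  by rewrite -[LHS](conjgK ((f^-1 : aut W) g)) -multiplicativeJ -fg autK.
- have [x gx] := g0 v; have [y fy] := f0 v.
  exists (y * f x).
  by rewrite -[LHS]/(f (g (vert v))) gx multiplicativeJ fy conjgM.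
Qed.

Lemma Aut0_sub_AutStar : Aut0 `<=` AutStar.
Proof.
move=> f f0; apply: AutStar_intro => D mD.
have [g fg] := Aut0_conj f0 (maxc_complete mD).
exists D, g; split=> //; apply/seteqP; split=> [_ [x Dx <-]|_ [x Dx <-]].
  by exists x => //; rewrite fg.
by exists x => //; rewrite fg.
Qed.

(** On the clique subgroup of [w], where [a v = w ^ g], the map [n] is conjugation by one [k]. So
    [n (a v) = w ^ (k * n g)] is a conjugate of [a v], and [a^-1] carries this back to [v]. *)
Lemma Aut0_normal n a : Aut0 n -> AutStar a -> Aut0 (n ^ a).
Proof.
move=> n0 aS v; have [D mD vD] := vertex_max_clique v.
have [D' [g [mD' aD]]] := AutStar_clique aS mD.
have [k nk] := Aut0_conj n0 (maxc_complete mD').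
have [w D'w av] : conj_set (sp D') g (a (vert v)).
  by rewrite -aD; exists (vert v) => //; apply: vertex_special.
exists ((a^-1 : aut W) (g^-1 * k * n g)).
rewrite -[LHS]/((a^-1 : aut W) (n (a (vert v)))).
rewrite -[in RHS](autK a (vert v)) -multiplicativeJ; congr (aut_val _ _).
by rewrite -av multiplicativeJ nk // -!conjgM !mulgA mulgV mul1g.
Qed.

(** An element of both groups sends [v] to a conjugate lying in a clique subgroup, so it fixes [v]
    by [special_conj_eq]. *)
Lemma Aut0I1 : Aut0 `&` Aut1 = [set 1].
Proof.
apply/seteqP; split=> [f [f0 f1]|_ ->]; last first.
  by split; apply: subgroup1; [apply: subgroup_Aut0|apply: subgroup_Aut1].
apply: autP; apply: (@graph_product_hom_ext _ f (1 : aut W)) => v.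
have [D mD vD] := vertex_max_clique v.
have [|D' mD' fD] := f1 (sp D); first by exists D.
have [g fv] := f0 v; rewrite fv.
apply: (@special_conj_eq D D'); [exact: maxc_complete..| |].
  exact: vertex_special.
by rewrite -fv -fD; exists (vert v) => //; apply: vertex_special.
Qed.

(** * Straightening and factorization of elements of [AutStar] *)

Definition straightens f (h : {multiplicative W -> W}) : Prop :=
  forall D, maxc D -> exists D' g,
    [/\ maxc D', f @` sp D = conj_set (sp D') g &
        forall x, sp D x -> f x = h x ^ g].

(* [h v] is the unique element of a clique subgroup conjugate to [f v]. *)
Lemma AutStar_straighten f : AutStar f -> exists h, straightens f h.
Proof.
move=> fS.
have /choice[a aP] : forall v, exists y, (exists2 D', maxc D' & sp D' y) /\
    exists g, f (vert v) = y ^ g.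
  move=> v; have [D mD vD] := vertex_max_clique v.
  have [D' [g [mD' fD]]] := AutStar_clique fS mD.
  have [y D'y fv] : conj_set (sp D') g (f (vert v)).
    by rewrite -fD; exists (vert v) => //; apply: vertex_special.
  by exists y; split; [exists D'|exists g].
(* [a v] was chosen through one clique containing [v]; by [special_conj_eq] it fits the conjugator
   of every other one. *)
have faE D D' g v : maxc D' -> f @` sp D = conj_set (sp D') g -> v \in D ->
    f (vert v) = a v ^ g.
  move=> mD' fD vD; have [[D2 mD2 D2a] [k fk]] := aP v.
  have [y D'y fv] : conj_set (sp D') g (f (vert v)).
    by rewrite -fD; exists (vert v) => //; apply: vertex_special.
  suff -> : a v = y by [].
  have yE : a v ^ (k * g^-1) = y by rewrite conjgM -fk -fv conjgK.
  rewrite -yE; symmetry.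
  apply: (special_conj_eq (maxc_complete mD2) (maxc_complete mD')) => //.
  by rewrite yE.
have [||h hv] := @graph_product_hom W a.
- move=> v n mv; have [_ [g fv]] := aP v; apply: (@conjg_inj _ g).
  rewrite conjXg -fv -multiplicativeX (vertex_order mv).
  by rewrite multiplicative1 conj1g.
(* A maximal clique through the edge gives [u] and [v] a common conjugator, so commutation passes
   from [f u], [f v] to [a u], [a v]. *)
- move=> u v uv; have [D [mD uD vD]] := edge_max_clique uv.
  have [D' [g [mD' fD]]] := AutStar_clique fS mD.
  apply: (@conjg_inj _ g); rewrite !conjMg -!(faE _ _ _ _ mD' fD) //.
  by rewrite -!gmulfM vertex_comm.
exists h => D mD; have [D' [g [mD' fD]]] := AutStar_clique fS mD.
exists D', g; split=> //.
pose c0 y := h y ^ g.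
have cM : {morph c0 : y z / y * z} by move=> y z; rewrite /c0 gmulfM conjMg.
pose c : {multiplicative W -> W} :=
  HB.pack c0 (isMultiplicative.Build _ _ c0 cM).
apply: (@special_hom_ext _ _ f c) => v vD /=.
by rewrite /c0 hv; apply: faE fD _.
Qed.

(** [h' (h v)] is conjugate to [v] and both lie in clique subgroups, hence they are equal. *)
Lemma straighten_inv f (h h' : {multiplicative W -> W}) :
  straightens f h -> straightens f^-1 h' -> cancel h h'.
Proof.
move=> hP h'P; apply: (@graph_product_hom_ext _ (h' \o h) idfun) => v /=.
have [D mD vD] := vertex_max_clique v.
have Dv := vertex_special vD.
have [D1 [g [mD1 fD fh]]] := hP D mD.
have hD1 x : sp D x -> sp D1 (h x).
  move=> Dx; have [y D1y] : conj_set (sp D1) g (f x) by rewrite -fD; exists x.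
  by rewrite fh // => /conjg_inj <-.
have [D2 [k [mD2 fD1 fh']]] := h'P D1 mD1.
have h'D2 x : sp D1 x -> sp D2 (h' x).
  move=> Dx; have [y D1y] : conj_set (sp D2) k ((f^-1 : aut W) x).
    by rewrite -fD1; exists x.
  by rewrite fh' // => /conjg_inj <-.
have vE : vert v ^ ((f^-1 : aut W) g^-1 * k^-1) = h' (h (vert v)).
  rewrite conjgM -{1}[vert v](autK f) -multiplicativeJ fh // conjgK.
  by rewrite fh' ?conjgK //; apply: hD1.
rewrite -vE.
apply: (special_conj_eq (maxc_complete mD) (maxc_complete mD2)) => //.
by rewrite vE; exact: h'D2 (hD1 _ Dv).
Qed.

Lemma AutStar_decomposition f : AutStar f ->
  exists2 n, Aut0 n & exists2 h, Aut1 h & n * h = f.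
Proof.
move=> fS; have fVS := subgroupV subgroup_AutStar fS.
have [h hP] := AutStar_straighten fS; have [h' h'P] := AutStar_straighten fVS.
have hK := straighten_inv hP h'P.
have h'K : cancel h' h by apply: straighten_inv h'P _; rewrite invgK.
pose H : aut W := @Aut W h (Bijective hK h'K).
have HVE x : (H^-1 : aut W) x = h' x.
  by rewrite -[x in LHS]h'K -[h _]/(H _) autK.
exists (f * H^-1); last first.
  exists H; last exact: mulgVK.
  move=> _ [D mD ->]; have [D' [g [mD' fD fh]]] := hP D mD.
  exists D' => //; apply/seteqP; split=> [_ [x Dx <-]|y D'y].
    have [y D'y] : conj_set (sp D') g (f x) by rewrite -fD; exists x.
    by rewrite fh // => /conjg_inj <-.
  have [x Dx] : (f @` sp D) (y ^ g) by rewrite fD; exists y.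
  by rewrite fh // => /conjg_inj <-; exists x.
move=> v; have [D mD vD] := vertex_max_clique v.
have [D' [k [mD' fD' fh']]] := h'P D mD.
have D'h' : sp D' (h' (vert v)).
  have [y D'y] : conj_set (sp D') k ((f^-1 : aut W) (vert v)).
    by rewrite -fD'; exists (vert v) => //; apply: vertex_special.
  by rewrite (fh' _ (vertex_special vD)) => /conjg_inj <-.
(* On [sp D'], [f] is [h] followed by conjugation by [g]; applied to [h' v] this gives [v ^ g]. *)
have [D2 [g [_ _ fh]]] := hP D' mD'.
exists g; rewrite -[LHS]/(f ((H^-1 : aut W) (vert v))) HVE fh //.
by rewrite h'K.
Qed.

End GraphProduct.

Theorem theorem1p4 (V : finType) (E : rel V) (m : V -> option nat)
    (V_nonempty : 0 < #|V|)
    (E_sym : symmetric E) (E_irr : irreflexive E)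
    (m_order : order_map m) :
  internal_sdprod (@Aut0 V E m) (@Aut1 V E m) (@AutStar V E m).
Proof.
split.
- by split; [apply: subgroup_AutStar|apply: subgroup_Aut0|apply: subgroup_Aut1].
- by split; [apply: Aut0_sub_AutStar|apply: Aut1_sub_AutStar].
- exact: Aut0_normal.
- exact: Aut0I1.
- apply/seteqP; split=> [f|_ [n n0 [h h1 <-]]].
    exact: AutStar_decomposition.
  have sA : subgroup (@AutStar V E m) by apply: subgroup_AutStar.
  have nA : AutStar n by apply: Aut0_sub_AutStar n0.
  have hA : AutStar h by apply: Aut1_sub_AutStar h1.
  exact: (subgroupM sA nA hA).
Qed.
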